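(* Let $n\ge 1$ and let $G=P_n$ be the path graph on $n$ vertices. Let $K$ be a field, $T=K[s_i,t_i: 1\le i\le n]$, and let $I\subset T$ be the monomial ideal of independent sets of $P_n$. Then the Betti numbers of $I$ are $$\beta_i(I)=\sum_{k=0}^{\left\lfloor\frac{n+1}{2}\right\rfloor}\binom{n+1-k}{k}\binom{k}{i},\qquad i\ge 0,$$ and the projective dimension of the quotient ring $T/I$ is $\mathrm{proj\,dim}(T/I)=\left\lfloor\frac{n+1}{2}\right\rfloor+1$.
   Context: $P_n$ is the graph on $\{1,\dots,n\}$ with edges $\{i,i+1\}$ for $1\le i\le n-1$. A set of vertices of a graph is independent if no two of its elements are adjacent (the empty set is independent). The monomial ideal of independent sets of a graph $G$ with vertex set $V(G)$ is the squarefree monomial ideal of $K[s_i,t_i:i\in V(G)]$ generated by the monomials $\prod_{r\in S}s_r\prod_{r\in V(G)\setminus S}t_r$, with $S$ ranging over all independent sets of $G$. $\beta_i(I)$ denotes the $i$-th total Betti number, i.e. the rank of the $i$-th free module in the minimal graded free resolution of $I$ over $T$ (with $\beta_0(I)$ the number of minimal generators of $I$). *)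

(* Defs.v *)
From HB Require Import structures.
From mathcomp Require Import all_boot all_order all_algebra.
From mathcomp Require Import boolp ring_quotient mpoly.

Set Implicit Arguments.
Unset Strict Implicit.
Unset Printing Implicit Defensive.

Import GRing.Theory.
Local Open Scope ring_scope.

Section IdealGeneratedBy.
Variables (R : comNzRingType) (J : finType) (A : {set J}) (g : J -> R).

(* The carrier is R^o so that the ideal is a submodule of R over itself, even
   when R (such as {mpoly K[n]}) also has another module structure. *)
Definition ideal_gen : pred R^o :=
  fun p => `[< exists c : J -> R, p = \sum_(j in A) c j * g j >].

Fact ideal_gen_submod_closed : subsemimod_closed ideal_gen.
Proof.
split; first split.
- apply/asboolP; exists (fun=> 0).
  by rewrite big1 // => j _; rewrite mul0r.
- move=> p q /asboolP[c ->] /asboolP[d ->]; apply/asboolP.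
  exists (fun j => c j + d j); rewrite -big_split.
  by apply: eq_bigr => j _; rewrite mulrDl.
- move=> a p /asboolP[c ->]; apply/asboolP; exists (fun j => a * c j).
  by rewrite scaler_sumr; apply: eq_bigr => j _; rewrite -mulrA.
Qed.

HB.instance Definition _ :=
  GRing.isSubmodClosed.Build R R^o ideal_gen ideal_gen_submod_closed.

End IdealGeneratedBy.

Section QuotientModule.
Variables (R : nzRingType) (M : lmodType R) (N : submodClosed M).
Local Open Scope quotient_scope.

(* submodClosed does not inherit from zmodClosed, which quotients require:
   closure under opposites is derived here from scaling by -1. *)
Definition submod_pred : pred M := [pred x in N].

Fact submod_pred_zmod_closed : zmod_closed submod_pred.
Proof. exact: GRing.submod_closedB (GRing.submodClosedP N). Qed.

HB.instance Definition _ :=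
  GRing.isZmodClosed.Build M submod_pred submod_pred_zmod_closed.

Definition quot_mod := Quotient.quot (GRing.ZmodClosed.clone M submod_pred _).
HB.instance Definition _ := GRing.Zmodule.on quot_mod.

Definition quot_pi (x : M) : quot_mod := \pi x.

Fact quot_pi_eq x y : (quot_pi x == quot_pi y) = (x - y \in N).
Proof. by rewrite -[LHS]Quotient.idealrBE. Qed.

Fact quot_reprK (x : quot_mod) : quot_pi (repr x) = x.
Proof. exact: reprK. Qed.

Fact quot_pi_zmod_morphism : zmod_morphism quot_pi.
Proof. by move=> x y; rewrite [LHS]raddfB. Qed.

HB.instance Definition _ :=
  GRing.isZmodMorphism.Build M quot_mod quot_pi quot_pi_zmod_morphism.

Definition quot_scale (a : R) (x : quot_mod) : quot_mod :=
  quot_pi (a *: repr x).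

Fact quot_scale_pi a x : quot_scale a (quot_pi x) = quot_pi (a *: x).
Proof.
by apply/eqP; rewrite quot_pi_eq -scalerBr rpredZ // -quot_pi_eq quot_reprK.
Qed.

Fact quot_scaleA a b x :
  quot_scale a (quot_scale b x) = quot_scale (a * b) x.
Proof. by rewrite -[x]quot_reprK !quot_scale_pi scalerA. Qed.

Fact quot_scale1 : left_id 1 quot_scale.
Proof. by move=> x; rewrite -[x]quot_reprK quot_scale_pi scale1r. Qed.

Fact quot_scaleDr : right_distributive quot_scale +%R.
Proof.
move=> a x y; rewrite -[x]quot_reprK -[y]quot_reprK.
by rewrite -raddfD !quot_scale_pi scalerDr raddfD.
Qed.

Fact quot_scaleDl x : {morph quot_scale^~ x : a b / a + b}.
Proof.
by move=> a b; rewrite -[x]quot_reprK !quot_scale_pi scalerDl raddfD.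
Qed.

HB.instance Definition _ := GRing.Zmodule_isLmodule.Build R quot_mod
  quot_scaleA quot_scale1 quot_scaleDr quot_scaleDl.

Fact quot_pi_scalable : scalable quot_pi.
Proof. by move=> a x; rewrite -quot_scale_pi. Qed.

HB.instance Definition _ :=
  GRing.isScalable.Build R M quot_mod *:%R quot_pi quot_pi_scalable.

End QuotientModule.

Section ProjectiveDimension.
Variable R : nzRingType.

Definition projective (P : lmodType R) : Prop :=
  forall (M N : lmodType R) (g : {linear M -> N}) (f : {linear P -> N}),
    (forall y, exists x, g x = y) ->
    exists h : {linear P -> M}, forall x, g (h x) = f x.

Record projective_resolution (M : lmodType R) := ProjectiveResolution {
  pr_mod : nat -> lmodType R;
  pr_aug : {linear pr_mod 0 -> M};
  pr_diff : forall i, {linear pr_mod i.+1 -> pr_mod i};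
  pr_projective : forall i, projective (pr_mod i);
  pr_aug_surj : forall y, exists x, pr_aug x = y;
  pr_exact0 : forall x, pr_aug x = 0 <-> exists y, x = pr_diff 0 y;
  pr_exact : forall i x,
    pr_diff i x = 0 <-> exists y, x = pr_diff i.+1 y
}.

Definition proj_dim_le (M : lmodType R) (d : nat) : Prop :=
  exists F : projective_resolution M,
    forall i, (d < i)%N -> forall x : pr_mod F i, x = 0.

Definition proj_dim_eq (M : lmodType R) (d : nat) : Prop :=
  proj_dim_le M d /\ forall e, proj_dim_le M e -> (d <= e)%N.

End ProjectiveDimension.

Section BettiNumbers.
Variables (K : fieldType) (m : nat).
Local Notation T := {mpoly K[m]}.

(* Homogeneous of degree z for the standard grading; 0 has every degree, and
   it is the only homogeneous polynomial of negative degree. *)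
Definition homogz (z : int) (p : T) : Prop :=
  forall u, u \in msupp p -> (mdeg u)%:Z = z.

(* The i-th module is \bigoplus_j T(- mr_shift i j), of rank mr_rank i, written
   as row vectors; the maps act by right multiplication by matrices.
   Minimality is d(F_(i+1)) \subset (x_1, ..., x_m) F_i. *)
Record min_graded_free_resolution (I : submodClosed T^o) := MinGradedFreeResolution {
  mr_rank : nat -> nat;
  mr_shift : forall i, 'I_(mr_rank i) -> int;
  mr_aug : 'cV[T]_(mr_rank 0);
  mr_diff : forall i, 'M[T]_(mr_rank i.+1, mr_rank i);
  mr_aug_homog : forall j, homogz (mr_shift j) (mr_aug j 0);
  mr_diff_homog : forall i j k,
    homogz (mr_shift j - mr_shift k) (mr_diff i j k);
  mr_aug_image : forall p,
    p \in I <-> exists x : 'rV_(mr_rank 0), p = (x *m mr_aug) 0 0;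
  mr_exact0 : forall x : 'rV_(mr_rank 0),
    x *m mr_aug = 0 <-> exists y, x = y *m mr_diff 0;
  mr_exact : forall i (x : 'rV_(mr_rank i.+1)),
    x *m mr_diff i = 0 <-> exists y, x = y *m mr_diff i.+1;
  mr_minimal : forall i j k, (mr_diff i j k)@_0%MM = 0
}.

(* beta_i(I) = b: a minimal graded free resolution of I exists, and the i-th
   rank is b in each of them. *)
Definition betti_eq (I : submodClosed T^o) (i b : nat) : Prop :=
  inhabited (min_graded_free_resolution I) /\
  forall F : min_graded_free_resolution I, mr_rank F i = b.

End BettiNumbers.

Section IndependentSetIdeal.
Variables (K : fieldType) (n : nat) (e : rel 'I_n).

Definition independent (S : {set 'I_n}) : bool :=
  [forall i in S, forall j in S, ~~ e i j].

(* K[s_i, t_i] is {mpoly K[n + n]}: the s_i come first, then the t_i. *)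
Definition s_var (i : 'I_n) : {mpoly K[n + n]} := 'X_(lshift n i).
Definition t_var (i : 'I_n) : {mpoly K[n + n]} := 'X_(rshift n i).

Definition indep_monomial (S : {set 'I_n}) : {mpoly K[n + n]} :=
  (\prod_(r in S) s_var r) * \prod_(r in ~: S) t_var r.

Definition indep_ideal : submodClosed {mpoly K[n + n]}^o :=
  GRing.SubmodClosed.clone _ _
    (ideal_gen [set S | independent S] indep_monomial) _.

End IndependentSetIdeal.

(* The vertex i.+1 of P_n is represented by i : 'I_n. *)
Definition path_graph (n : nat) : rel 'I_n :=
  fun i j => (i.+1 == j :> nat) || (j.+1 == i :> nat).

(* Main.v *)
Require Import Defs.
From HB Require Import structures.
From mathcomp Require Import all_boot all_order all_algebra.
From mathcomp Require Import boolp mpoly ring zify.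

(** The independent sets of a graph form a simplicial complex D, that is, a
    family closed under taking subsets, and the ideal generated by the
    monomials m_S = (product of the s_r, r in S) (product of the t_r, r not in
    S) for S in D has an explicit linear resolution for every such D. Its
    basis in degree i consists of the pairs (S, A) with S in D, A included in
    S and #|A| = i. Such a pair is a cube whose vertices are the sets S minus
    B for B included in A, and the differential is the cubical one,
    homogenized:
      d (S, A) = sum over a in A of
                 +- (t_a (S, A minus a) - s_a (S minus a, A minus a)).

    Exactness ([cube_acyclic]) comes from one contracting homotopy for each
    vertex v ([cube_htpy]), which moves from the face (S, A minus v) back to
    (S, A) and divides the coefficient by t_v. Homotopies of this kind replace
    a cycle by a homologous one in normal form, without any cube of positive
    dimension and with no multiple of t_v in the coefficient at a set S that
    contains v. In positive degree such a cycle is 0. In degree 0 the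
    augmentation is injective on normal forms ([cube_aug_normal_eq0]), because
    S can be read off the monomials of its contribution.

    The entries of the differentials are variables up to sign, so the
    resolution is minimal. That the ranks of a minimal resolution, and its
    length, are invariants of the ideal follows from the comparison of
    projective resolutions ([comparison_homotopy]): the identity of a minimal
    resolution factors through any other resolution up to homotopy, and the
    homotopy terms disappear when the variables are set to 0
    ([mr_rank_unique], [proj_dim_quotient]). This needs the ideal to be
    proper, which is where n > 0 enters.

    The rank in degree i is therefore the sum over S in D of the binomial
    coefficient of #|S| and i ([cube_rankE]), and for the path it remains to
    count the independent sets of size k: there are 'C(n + 1 - k, k) of them
    ([card_path_indep_sets]), by Pascal's rule. *)

Set Implicit Arguments.
Unset Strict Implicit.
Unset Printing Implicit Defensive.

Import GRing.Theory.
Local Open Scope ring_scope.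

(** * Projective resolutions *)

Section LinearImage.
Variables (R : nzRingType) (M N : lmodType R) (g : {linear M -> N}).

Definition limage : pred N := fun y => `[< exists x, g x = y >].

Fact limage_submod_closed : subsemimod_closed limage.
Proof.
split; first split.
- by apply/asboolP; exists 0; rewrite linear0.
- move=> _ _ /asboolP[x <-] /asboolP[y <-]; apply/asboolP.
  by exists (x + y); rewrite linearD.
- move=> a _ /asboolP[x <-]; apply/asboolP.
  by exists (a *: x); rewrite linearZ.
Qed.

HB.instance Definition _ :=
  GRing.isSubmodClosed.Build R N limage limage_submod_closed.

(** The image of a linear map as a module in its own right: projectivity in the
    sense used here only speaks of surjections, so a lift along a map with a
    smaller image is a lift along its corestriction to this module. *)
Definition limage_type := {y : N | limage y}.
HB.instance Definition _ := SubChoice.on limage_type.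
HB.instance Definition _ := [SubChoice_isSubLmodule of limage_type by <:].

End LinearImage.

Lemma projective_lift (R : nzRingType) (P M N : lmodType R)
    (g : {linear M -> N}) (f : {linear P -> N}) :
  projective P -> (forall x, exists y, f x = g y) ->
  exists h : {linear P -> M}, forall x, g (h x) = f x.
Proof.
move=> projP fg.
have imP x : limage g (f x) by apply/asboolP; have [y ->] := fg x; exists y.
have imM x : limage g (g x) by apply/asboolP; exists x.
pose f' x : limage_type g := Sub (f x) (imP x).
pose g' x : limage_type g := Sub (g x) (imM x).
have lf : linear f' by move=> a x y; apply/val_inj; rewrite /= linearP.
have lg : linear g' by move=> a x y; apply/val_inj; rewrite /= linearP.
pose F := GRing.isLinear.Build _ _ _ _ f' lf.
pose G := GRing.isLinear.Build _ _ _ _ g' lg.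
pose f1 : {linear P -> limage_type g} := HB.pack f' F.
pose g1 : {linear M -> limage_type g} := HB.pack g' G.
have [|h hE] := projP _ _ g1 f1.
  by case=> y iy; have /asboolP[x xy] := iy; exists x; apply/val_inj.
by exists h => x; have /(congr1 val) := hE x.
Qed.

(** ** Comparison of two projective resolutions *)

Section Comparison.
Variables (R : nzRingType) (M : lmodType R).
Implicit Types P Q : projective_resolution M.

(** The augmentation plays the role of the differential out of degree 0. *)
Definition pr_cycle P i : pr_mod P i -> Prop :=
  match i with
  | 0 => fun x => pr_aug P x = 0
  | j.+1 => fun x => pr_diff P j x = 0
  end.

Lemma pr_cycleP P i (x : pr_mod P i) :
  pr_cycle x <-> exists y, x = pr_diff P i y.
Proof. by case: i x => [|i] x; [apply: pr_exact0 | apply: pr_exact]. Qed.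

Lemma pr_diffK P i (x : pr_mod P i.+1) : pr_cycle (pr_diff P i x).
Proof. by apply/pr_cycleP; exists x. Qed.

Section Degree.
Variables (P Q : projective_resolution M).

(** What an induction on the degree has to remember of two chain maps, back and
    forth, and of a homotopy: the maps preserve cycles, and on cycles the
    composite differs from the identity by a boundary that is chosen linearly.
    This says nothing of the lower degrees, so the comparison is obtained by a
    plain induction instead of the construction of infinite families. *)
Definition comparison_at i (phi : pr_mod P i -> pr_mod Q i)
    (psi : pr_mod Q i -> pr_mod P i) (h : pr_mod P i -> pr_mod P i.+1) :=
  [/\ forall x, pr_cycle x -> pr_cycle (phi x),
      forall x, pr_cycle x -> pr_cycle (psi x) &
      forall x, pr_cycle x -> psi (phi x) + pr_diff P i (h x) = x].

Lemma comparison_at0 :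
  exists (phi : {linear pr_mod P 0 -> pr_mod Q 0})
         (psi : {linear pr_mod Q 0 -> pr_mod P 0})
         (h : {linear pr_mod P 0 -> pr_mod P 1}), comparison_at phi psi h.
Proof.
have [|phi phiE] := projective_lift (g := pr_aug Q) (f := pr_aug P)
    (@pr_projective _ _ P 0).
  by move=> x; have [y <-] := pr_aug_surj Q (pr_aug P x); exists y.
have [|psi psiE] := projective_lift (g := pr_aug P) (f := pr_aug Q)
    (@pr_projective _ _ Q 0).
  by move=> x; have [y <-] := pr_aug_surj P (pr_aug Q x); exists y.
pose f : {linear pr_mod P 0 -> pr_mod P 0} := idfun \- (psi \o phi).
have [|h hE] := projective_lift (g := pr_diff P 0) (f := f)
    (@pr_projective _ _ P 0).
  by move=> x; apply/pr_exact0; rewrite /= linearB psiE phiE subrr.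
exists phi, psi, h; split=> [x|x|x _] /=.
- by rewrite phiE.
- by rewrite psiE.
- by rewrite hE /= subrKC.
Qed.

(** In degree i.+1 the maps phi and psi compose with the differential to maps
    into cycles, hence into boundaries, so they lift by projectivity; the
    difference id - psi' phi' - h d is killed by the differential because d x is
    a cycle, and lifts to h' in turn. *)
Lemma comparison_atS i (phi : {linear pr_mod P i -> pr_mod Q i})
    (psi : {linear pr_mod Q i -> pr_mod P i})
    (h : {linear pr_mod P i -> pr_mod P i.+1}) :
  comparison_at phi psi h ->
  exists (phi' : {linear pr_mod P i.+1 -> pr_mod Q i.+1})
         (psi' : {linear pr_mod Q i.+1 -> pr_mod P i.+1})
         (h' : {linear pr_mod P i.+1 -> pr_mod P i.+2}),
    comparison_at phi' psi' h' /\
    forall x, psi' (phi' x) + pr_diff P i.+1 (h' x) + h (pr_diff P i x) = x.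
Proof.
move=> [phiZ psiZ hE].
pose f : {linear pr_mod P i.+1 -> pr_mod Q i} := phi \o pr_diff P i.
have [|phi' phiE] := projective_lift (g := pr_diff Q i) (f := f)
    (@pr_projective _ _ P i.+1).
  by move=> x; apply/pr_cycleP/phiZ/pr_diffK.
pose g : {linear pr_mod Q i.+1 -> pr_mod P i} := psi \o pr_diff Q i.
have [|psi' psiE] := projective_lift (g := pr_diff P i) (f := g)
    (@pr_projective _ _ Q i.+1).
  by move=> x; apply/pr_cycleP/psiZ/pr_diffK.
pose k : {linear pr_mod P i.+1 -> pr_mod P i.+1} :=
  idfun \- (psi' \o phi') \- (h \o pr_diff P i).
have [|h' h'E] := projective_lift (g := pr_diff P i.+1) (f := k)
    (@pr_projective _ _ P i.+1).
  move=> x; apply/pr_exact; rewrite /= !linearB /= psiE /= phiE /=.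
  by rewrite -addrA -opprD hE ?subrr//; apply: pr_diffK.
have homotopy x :
    psi' (phi' x) + pr_diff P i.+1 (h' x) + h (pr_diff P i x) = x.
  by rewrite h'E /= addrA subrKC subrK.
exists phi', psi', h'; split=> //; split=> x /= xZ.
- by rewrite phiE /= xZ linear0.
- by rewrite psiE /= xZ linear0.
- by rewrite -[RHS]homotopy xZ linear0 addr0.
Qed.

(** The degree 0 part of a resolution of a quotient ring is the ring itself, and
    its interesting degrees are the positive ones; only these are kept. *)
Lemma comparison_homotopy i :
  exists (phi : {linear pr_mod P i.+1 -> pr_mod Q i.+1})
         (psi : {linear pr_mod Q i.+1 -> pr_mod P i.+1})
         (h : {linear pr_mod P i.+1 -> pr_mod P i.+2})
         (k : {linear pr_mod P i -> pr_mod P i.+1}),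
    forall x, psi (phi x) + pr_diff P i.+1 (h x) + k (pr_diff P i x) = x.
Proof.
suff [phi [psi [k cmp]]] : exists (phi : {linear pr_mod P i -> pr_mod Q i})
    (psi : {linear pr_mod Q i -> pr_mod P i})
    (h : {linear pr_mod P i -> pr_mod P i.+1}), comparison_at phi psi h.
  have [phi' [psi' [h [_ homotopy]]]] := comparison_atS cmp.
  by exists phi', psi', h, k.
elim: i => [|i [phi [psi [h /comparison_atS [phi' [psi' [h' [cmp _]]]]]]]].
  exact: comparison_at0.
by exists phi', psi', h'.
Qed.

End Degree.
End Comparison.

(** * Minimal free resolutions and quotient rings *)

Lemma rV_projective (R : nzRingType) k : projective 'rV[R]_k.
Proof.
move=> M N g f gsurj; have /choice[s sE] := gsurj.
pose h (x : 'rV[R]_k) := \sum_(i < k) x 0 i *: s (f (delta_mx 0 i)).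
have hlin : linear h.
  move=> a x y; rewrite scaler_sumr -big_split; apply: eq_bigr => i _ /=.
  by rewrite !mxE scalerDl scalerA.
pose H := GRing.isLinear.Build _ _ _ _ h hlin.
exists (HB.pack h H : {linear _ -> _}) => x /=.
rewrite linear_sum [in RHS](row_sum_delta x) linear_sum.
by apply: eq_bigr => i _; rewrite !linearZ /= sE.
Qed.

Section QuotientResolution.
Variables (K : fieldType) (m : nat) (I : submodClosed {mpoly K[m]}^o).
Local Notation T := {mpoly K[m]}.
Implicit Types F G : min_graded_free_resolution I.

(** A free resolution of I becomes one of T/I once T is put in degree 0 and the
    other modules are moved up by one degree. *)
Definition qr_rank F i := if i is j.+1 then mr_rank F j else 1%N.

Definition qr_diff F i : 'M[T]_(qr_rank F i.+1, qr_rank F i) :=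
  if i is j.+1 then mr_diff F j else mr_aug F.

Definition qr_aug (x : 'rV[T]_1) : quot_mod I := quot_pi I (x 0 0).

Fact qr_aug_linear : linear qr_aug.
Proof. by move=> a x y; rewrite /qr_aug !mxE; apply: (linearP (quot_pi I)). Qed.

HB.instance Definition _ :=
  GRing.isLinear.Build _ _ _ _ qr_aug qr_aug_linear.

Lemma qr_aug_eq0 x : qr_aug x = 0 <-> x 0 0 \in I.
Proof.
rewrite /qr_aug -(linear0 (quot_pi I)); split.
  by move/eqP; rewrite quot_pi_eq subr0.
by move=> xI; apply/eqP; rewrite quot_pi_eq subr0.
Qed.

Lemma qr_exact0 F (x : 'rV[T]_1) :
  qr_aug x = 0 <-> exists y, x = mulmxr (qr_diff F 0) y.
Proof.
rewrite qr_aug_eq0; split; first move/(mr_aug_image F).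
  by case=> y xE; exists y; apply/matrixP => i j; rewrite !ord1 xE.
by case=> y ->; apply/(mr_aug_image F); exists y.
Qed.

Lemma qr_exact F i (x : 'rV[T]_(qr_rank F i.+1)) :
  mulmxr (qr_diff F i) x = 0 <-> exists y, x = mulmxr (qr_diff F i.+1) y.
Proof. by case: i x => [|i] x /=; [apply: mr_exact0 | apply: mr_exact]. Qed.

Lemma qr_aug_surj y : exists x, qr_aug x = y.
Proof.
by exists (const_mx (repr y)); rewrite /qr_aug mxE quot_reprK.
Qed.

Definition quotient_resolution F : projective_resolution (quot_mod I) :=
  @ProjectiveResolution T (quot_mod I) (fun i => 'rV[T]_(qr_rank F i))
    qr_aug (fun i => mulmxr (qr_diff F i)) (fun i => @rV_projective _ _)
    qr_aug_surj (@qr_exact0 F) (@qr_exact F).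

(** The augmentation of the resolution of I becomes a differential of the
    resolution of T/I; the latter is minimal as soon as I is contained in the
    maximal ideal generated by the variables. *)
Hypothesis I_proper : forall p : T, p \in I -> p@_0%MM = 0.

Lemma qr_diff_minimal F i : map_mx (mcoeff 0%MM) (qr_diff F i) = 0.
Proof.
apply/matrixP => j k; rewrite !mxE; case: i j k => [|i] j k /=; last first.
  exact: mr_minimal.
apply: I_proper; apply/(mr_aug_image F); exists (delta_mx 0 j).
by rewrite -rowE mxE [k]ord1.
Qed.

(** Modulo the variables all differentials vanish, so that a map homotopic to
    the identity becomes the identity. *)
Lemma homotopy_mod_maximal F i
    (f : {linear 'rV[T]_(qr_rank F i.+1) -> 'rV[T]_(qr_rank F i.+1)})
    (h : {linear 'rV[T]_(qr_rank F i.+1) -> 'rV[T]_(qr_rank F i.+2)})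
    (k : {linear 'rV[T]_(qr_rank F i) -> 'rV[T]_(qr_rank F i.+1)}) :
  (forall x, f x + h x *m qr_diff F i.+1 + k (x *m qr_diff F i) = x) ->
  map_mx (mcoeff 0%MM) (lin1_mx f) = 1%:M.
Proof.
move=> fE.
have /(congr1 (map_mx (mcoeff 0%MM))) :
    lin1_mx f + lin1_mx h *m qr_diff F i.+1 + qr_diff F i *m lin1_mx k = 1%:M.
  apply/row_matrixP => j; rewrite !rowE !mulmxDr !mulmxA !mul_rV_lin1 mulmx1.
  exact: fE.
rewrite !map_mxD !map_mxM !qr_diff_minimal mulmx0 mul0mx !addr0 => ->.
exact: map_mx1.
Qed.

(** The identity of F factors through G up to homotopy, hence strictly once the
    variables are set to 0: an identity matrix of the size of F_i is then a
    product of two matrices through the size of G_i. *)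
Lemma mr_rank_le F G i : (mr_rank F i <= mr_rank G i)%N.
Proof.
have [phi [psi [h [k hE]]]] :=
  comparison_homotopy (quotient_resolution F) (quotient_resolution G) i.
have := @homotopy_mod_maximal F i (psi \o phi) h k hE.
have -> : lin1_mx (psi \o phi) = lin1_mx phi *m lin1_mx psi.
  by apply/row_matrixP => j; rewrite !rowE mulmxA !mul_rV_lin1.
rewrite map_mxM => /(congr1 mxrank); rewrite mxrank1 /= => <-.
by apply: leq_trans (mxrankM_maxl _ _) _; apply: rank_leq_col.
Qed.

Lemma mr_rank_unique F G i : mr_rank F i = mr_rank G i.
Proof. by apply/eqP; rewrite eqn_leq !mr_rank_le. Qed.

(** If a projective resolution Q of T/I stopped before degree d.+1, then the
    identity of the last module of the minimal resolution would be homotopic to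
    a map through 0, so it would vanish modulo the variables. The terms of Q may
    be of infinite rank: only the maps between the terms of F are ever written
    as matrices. *)
Lemma proj_dim_quotient F d :
  (0 < mr_rank F d)%N -> (forall i, (d < i)%N -> mr_rank F i = 0%N) ->
  proj_dim_eq (quot_mod I) d.+1.
Proof.
move=> Fd_gt0 F_eq0; split.
  exists (quotient_resolution F) => -[|i] //= di x.
  by move: x; rewrite /= F_eq0 // => x; apply/matrixP => j [].
move=> e [Q Q_eq0]; rewrite ltnNge; apply/negP => le_ed.
have [phi [psi [h [k hE]]]] := comparison_homotopy (quotient_resolution F) Q d.
pose z : {linear 'rV[T]_(qr_rank F d.+1) -> 'rV[T]_(qr_rank F d.+1)} :=
  psi \o phi.
have z0 x : z x = 0 by rewrite /z /= (Q_eq0 d.+1 _ (phi x)) ?linear0.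
have := @homotopy_mod_maximal F d z h k hE.
have -> : lin1_mx z = 0.
  by apply/row_matrixP => j; rewrite rowE mul_rV_lin1 z0 row0.
rewrite map_mx0 => /matrixP/(_ (Ordinal Fd_gt0) (Ordinal Fd_gt0))/eqP.
by rewrite !mxE eqxx eq_sym oner_eq0.
Qed.

End QuotientResolution.

(** * The cube complex of a simplicial complex *)

Section DivisionByVariable.
Variables (R : comNzRingType) (m : nat).
Implicit Types (p : {mpoly R[m]}) (u : 'X_{1..m}) (i j : 'I_m).

(** The R-linear map that divides by a variable the monomials that it divides,
    and sends the others to 0. It commutes with the multiplication by the other
    variables, which makes it usable in contracting homotopies. *)
Definition divX i p : {mpoly R[m]} :=
  \sum_(u : 'X_{1..m < msize p}) p@_(u + U_(i))%MM *: 'X_[u].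

Lemma mcoeff_divX i p u : (divX i p)@_u = p@_(u + U_(i))%MM.
Proof.
have [u_lt|u_ge] := ltnP (mdeg u) (msize p).
  exact: (@mcoeff_mpoly _ _ (fun u => p@_(u + U_(i))%MM)).
rewrite [RHS]memN_msupp_eq0; last first.
  by rewrite msize_mdeg_ge // mdegD (leq_trans u_ge) // leq_addr.
rewrite raddf_sum big1 // => v _ /=; rewrite mcoeffZ mcoeffX.
case: eqP => [vu|_]; last by rewrite mulr0.
by have := bmdeg v; rewrite vu ltnNge u_ge.
Qed.

Lemma divX_linear i : linear (divX i).
Proof.
by move=> a p q; apply/mpolyP => u; rewrite !(mcoeffD, mcoeffZ, mcoeff_divX).
Qed.

HB.instance Definition _ i :=
  GRing.isLinear.Build R {mpoly R[m]} {mpoly R[m]} _ (divX i) (divX_linear i).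

Lemma divX_mulX i p : divX i ('X_i * p) = p.
Proof.
apply/mpolyP => u; rewrite mcoeff_divX [_ * p]mulrC [(u + _)%MM]addmC.
exact: mcoeffMX.
Qed.

Lemma mcoeff_mulX0 j p u : u j = 0%N -> ('X_j * p)@_u = 0.
Proof.
move=> uj; rewrite mulrC; apply/memN_msupp_eq0.
rewrite (perm_mem (msuppMX _ _)).
by apply/mapP => -[v _ uE]; move: uj; rewrite uE mnmDE mnm1E eqxx.
Qed.

Lemma divX_mulX_neq i j p : j != i -> divX i ('X_j * p) = 'X_j * divX i p.
Proof.
move=> ji; apply/mpolyP => u; rewrite mcoeff_divX.
have [uj|uj] := eqVneq (u j) 0%N.
  by rewrite !mcoeff_mulX0 // mnmDE uj mnm1E eq_sym (negbTE ji).
rewrite -lep1mP in uj; rewrite -(submK uj) -addmA addmC -addmA mulrC mcoeffMX.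
by rewrite mulrC [(_ + U_(j))%MM]addmC mcoeffMX mcoeff_divX addmC.
Qed.

Lemma divXC i j p : divX i (divX j p) = divX j (divX i p).
Proof.
apply/mpolyP => u; do 2 rewrite [LHS]mcoeff_divX [RHS]mcoeff_divX.
by rewrite -addmA [(U_(i) + _)%MM]addmC addmA.
Qed.

Lemma divX_eq0_msupp i p u : divX i p = 0 -> u \in msupp p -> u i = 0%N.
Proof.
move=> p0; apply: contraTeq; rewrite -lep1mP => /submK <-.
by rewrite mcoeff_msupp negbK -mcoeff_divX p0 mcoeff0.
Qed.

End DivisionByVariable.

(** The vanishing of the diagonal has to be assumed, and opposite terms paired,
    since 2 may be 0. *)
Lemma sum_antisymmetric (V : zmodType) n (F : 'I_n -> 'I_n -> V) :
  (forall a, F a a = 0) -> (forall a b, F a b = - F b a) ->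
  \sum_a \sum_b F a b = 0.
Proof.
move=> F0 FN; have Fsplit a : \sum_b F a b =
    \sum_(b < n | (b < a)%N) F a b + \sum_(b < n | (a < b)%N) F a b.
  rewrite (bigID (fun b : 'I_n => (b < a)%N)) /=; congr (_ + _).
  rewrite (bigD1 a) ?ltnn //= F0 add0r; apply: eq_bigl => b.
  by rewrite -leqNgt ltn_neqAle andbC eq_sym.
rewrite (eq_bigr _ (fun a _ => Fsplit a)) big_split /=.
rewrite [X in X + _](exchange_big_dep xpredT) //= -big_split big1 // => a _ /=.
by rewrite -big_split big1 // => b _ /=; rewrite FN addNr.
Qed.

Section CubeComplex.
Variables (K : fieldType) (n : nat) (D : {set {set 'I_n}}).
Hypothesis D_down :
  forall S S' : {set 'I_n}, S \in D -> S' \subset S -> S' \in D.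
Local Notation T := {mpoly K[n + n]}.
Local Notation t_idx v := (rshift n v).
Implicit Types (a b v w : 'I_n) (S A : {set 'I_n}).
Implicit Types f g : {set 'I_n} -> {set 'I_n} -> T.

(** The exponent of the sign of the position of a in A. *)
Definition inversions a A := (\sum_(b in A) (b < a))%N.

(** Label a cube by the least common multiple of the m_S of its vertices S. The
    faces of (S, A) in the direction a are (S, A minus a), where the label loses
    the factor t_a, and (S minus a, A minus a), where it loses s_a; they come
    with opposite signs. *)
Definition incidence a S : T := if a \in S then t_var K a else - s_var K a.

(** A chain is a function on pairs of sets, the pair (S, A) with A included in S
    standing for the cube with vertices S minus B for B included in A. Read from
    its value at a face, the differential collects the cubes with that face, and
    (a |: S, a |: A) is the unique such cube in the direction a when a is not in
    A: incidence a S tells whether the face is on the side of a or not. *)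
Definition cube_diff f S A : T :=
  \sum_(a | a \notin A)
    (-1) ^+ inversions a A * (incidence a S * f (a |: S) (a |: A)).

Definition cube_aug f : T := \sum_S f S set0 * indep_monomial K S.

Definition cells i := [set q : {set 'I_n} * {set 'I_n} |
  [&& q.1 \in D, q.2 \subset q.1 & #|q.2| == i]].

Definition chain i f := forall S A, (S, A) \notin cells i -> f S A = 0.

(** Contraction in the direction v: it sends a multiple of the face on the side
    of v back to the cube, after division by t_v when this is possible. It never
    enlarges S, so it preserves every simplicial complex. *)
Definition cube_htpy v f S A : T :=
  if (v \in A) && (v \in S)
  then (-1) ^+ inversions v (A :\ v) * divX (t_idx v) (f S (A :\ v)) else 0.

Lemma inversionsU1 a b A :
  b \notin A -> inversions a (b |: A) = ((b < a) + inversions a A)%N.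
Proof. exact: big_setU1. Qed.

Lemma cube_diffB f g S A :
  cube_diff (fun S A => f S A - g S A) S A = cube_diff f S A - cube_diff g S A.
Proof.
by rewrite /cube_diff -sumrB; apply: eq_bigr => a _; rewrite !mulrBr.
Qed.

Lemma cube_augB f g :
  cube_aug (fun S A => f S A - g S A) = cube_aug f - cube_aug g.
Proof. by rewrite /cube_aug -sumrB; apply: eq_bigr => S _; rewrite mulrBl. Qed.

Lemma eq_cube_diff f g : (forall S A, f S A = g S A) ->
  forall S A, cube_diff f S A = cube_diff g S A.
Proof. by move=> fg S A; apply: eq_bigr => a _; rewrite fg. Qed.

Lemma incidence_setU1 a b S :
  a != b -> incidence a (b |: S) = incidence a S.
Proof. by move=> ab; rewrite /incidence !inE (negbTE ab). Qed.

Lemma cube_diffK f S A : cube_diff (cube_diff f) S A = 0.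
Proof.
pose F a b : T := if [&& a \notin A, b \notin A & a != b] then
  (-1) ^+ inversions a A * ((-1) ^+ ((a < b) + inversions b A) *
   (incidence a S * incidence b S * f (b |: (a |: S)) (b |: (a |: A)))) else 0.
rewrite -[RHS](@sum_antisymmetric _ _ F) => [|a|a b].
- rewrite /cube_diff big_mkcond; apply: eq_bigr => a _ /=.
  case: ifP => aA; last by rewrite big1 // => b _; rewrite /F aA.
  rewrite mulr_sumr mulr_sumr big_mkcond; apply: eq_bigr => b _ /=.
  rewrite /F aA !inE negb_or eq_sym [(a != b) && _]andbC.
  case: ifP => // /andP[_ ab].
  rewrite inversionsU1 // incidence_setU1 1?eq_sym //= -!mulrA.
  by congr (_ * _); rewrite mulrCA.
- by rewrite /F eqxx !andbF.
rewrite /F andbCA eq_sym.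
case: ifP => [/and3P[_ _ ba]|_]; last by rewrite oppr0.
have -> : (b < a)%N = ~~ (a < b)%N by rewrite ltn_neqAle -leqNgt ba.
rewrite [b |: (a |: S)]setUCA [b |: (a |: A)]setUCA !exprD.
by case: (a < b)%N; rewrite /= expr0 expr1; ring.
Qed.

Lemma setU1_id a S : a \in S -> a |: S = S.
Proof. by move=> aS; apply/setUidPr; rewrite sub1set. Qed.

(** For a in S, the labels satisfy t_a m_S = s_a m_(S minus a). *)
Lemma cube_aug_diff f : cube_aug (cube_diff f) = 0.
Proof.
rewrite /cube_aug /cube_diff.
transitivity (\sum_S \sum_(a : 'I_n)
    incidence a S * f (a |: S) [set a] * indep_monomial K S).
  apply: eq_bigr => S _; rewrite mulr_suml.
  apply: eq_big => a; first by rewrite inE.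
  by rewrite /inversions big_set0 expr0 mul1r setU0.
rewrite exchange_big big1 // => a _; rewrite (bigID (fun S => a \in S)) /=.
(* Each S without a is S' minus a for a unique S' containing a. *)
rewrite [X in _ + X](reindex_onto (fun S => S :\ a) (fun S => a |: S)) /=;
  last by move=> S aS; rewrite setU1K.
rewrite [X in _ + X](eq_bigl (fun S => a \in S)) => [|S]; last first.
  rewrite !inE eqxx /=; apply/eqP/idP => [<-|]; first by rewrite !inE eqxx.
  by move/setD1K.
rewrite -big_split big1 // => S aS /=; rewrite /incidence !inE eqxx aS /=.
rewrite setD1K // setU1_id // /indep_monomial (big_setD1 a aS) /=.
rewrite [\prod_(r in ~: (S :\ a)) _](big_setD1 a) ?inE ?eqxx //=.
have -> : (~: (S :\ a)) :\ a = ~: S.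
  apply/setP => b; rewrite !inE negb_and negbK.
  by have [->|] := eqVneq b a; rewrite ?aS.
by ring.
Qed.

Lemma divX_incidence v a S p : a != v ->
  divX (t_idx v) (incidence a S * p) = incidence a S * divX (t_idx v) p.
Proof.
move=> av; rewrite /incidence; case: ifP => _; last rewrite !mulNr raddfN /=.
  by rewrite divX_mulX_neq // (inj_eq (@rshift_inj _ _)).
by rewrite divX_mulX_neq // -val_eqE /= neq_ltn ltn_addr.
Qed.

(** Only the term in the direction v of the differential interacts with the
    homotopy; all others cancel since crossing v changes the sign. *)
Lemma cube_htpyP v f S A : v \in A -> v \in S ->
  cube_diff (cube_htpy v f) S A + cube_htpy v (cube_diff f) S A = f S A.
Proof.
move=> vA vS; have vB : v \notin A :\ v by rewrite !inE eqxx.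
rewrite /cube_htpy vA vS /= {2}/cube_diff (bigD1 v) //= raddfD /=.
rewrite raddfMsign /= /incidence vS divX_mulX setU1_id // setD1K //.
rewrite mulrDr signrMK addrCA -[RHS]addr0; congr (_ + _).
rewrite raddf_sum mulr_sumr /cube_diff.
rewrite [X in _ + X](eq_bigl (fun a => a \notin A)) => [|a]; last first.
  by rewrite !inE negb_and negbK; have [->|] := eqVneq a v; rewrite ?vA ?andbT.
rewrite -big_split big1 // => a aA /=.
have av : a != v by apply: contraNneq aA => ->.
have aB : a \notin A :\ v by rewrite !inE (negbTE aA) andbF.
rewrite raddfMsign /= -/(incidence a S) divX_incidence // !inE vA vS !orbT /=.
have -> : (a |: A) :\ v = a |: A :\ v.
  by apply/setP => b; rewrite !inE; have [->|] := eqVneq b a; rewrite ?av.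
rewrite inversionsU1 // -[in inversions a A](setD1K vA) inversionsU1 // !exprD.
have -> : (v < a)%N = ~~ (a < v)%N by rewrite ltn_neqAle -leqNgt eq_sym av.
by case: (a < v)%N; rewrite /= expr0 expr1; ring.
Qed.

Lemma cube_diff_htpy v f S A : v \notin A ->
  cube_diff (cube_htpy v f) S A = incidence v S * divX (t_idx v) (f (v |: S) A).
Proof.
move=> vA; rewrite /cube_diff (bigD1 v) //= big1 ?addr0 => [|a /andP[aA av]].
  by rewrite /cube_htpy !inE eqxx /= setU1K // mulrCA signrMK.
by rewrite /cube_htpy !inE eq_sym (negbTE av) (negbTE vA) !mulr0.
Qed.

Lemma cellsP i S A :
  reflect [/\ S \in D, A \subset S & #|A| = i] ((S, A) \in cells i).
Proof. by rewrite inE; apply: (iffP and3P) => -[? ? /eqP]. Qed.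

Lemma chain_diff i f : chain i.+1 f -> chain i (cube_diff f).
Proof.
move=> fi S A SAi; rewrite /cube_diff big1 // => a aA.
rewrite fi ?mulr0 //; apply: contra SAi => /cellsP[aSD aAS aAi].
apply/cellsP; split.
- by apply: D_down aSD _; apply: subsetUr.
- apply/subsetP => b bA.
  have /(subsetP aAS) : b \in a |: A by rewrite inE bA orbT.
  by rewrite !inE => /predU1P[ba|//]; rewrite -ba bA in aA.
- by move: aAi; rewrite cardsU1 aA => -[].
Qed.

Lemma chain_htpy i v f : chain i f -> chain i.+1 (cube_htpy v f).
Proof.
move=> fi S A SAi; rewrite /cube_htpy; case: ifP => // /andP[vA vS].
rewrite fi ?raddf0 ?mulr0 //; apply: contra SAi => /cellsP[SD AS Ai].
apply/cellsP; split=> //; last by rewrite (cardsD1 v) vA Ai.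
by rewrite -(setD1K vA) subUset sub1set vS.
Qed.

Lemma chainB i f g :
  chain i f -> chain i g -> chain i (fun S A => f S A - g S A).
Proof. by move=> fi gi S A SAi; rewrite fi // gi // subr0. Qed.

(** A chain in normal form in the direction v has no cube in that direction, and
    on the sets that contain v its coefficients have no multiple of t_v. *)
Definition normal_at v f := forall S A, v \in S ->
  (v \in A -> f S A = 0) /\ divX (t_idx v) (f S A) = 0.

Definition cube_cycle f := forall S A, cube_diff f S A = 0.

(** Subtracting this boundary from a cycle puts it in normal form at v, and
    keeps the normal form that it may already have in the other directions. *)
Definition strip v f S A := f S A - cube_diff (cube_htpy v f) S A.

Lemma strip_eq0 v f i S A :
  chain i f -> cube_cycle f -> v \in A -> strip v f S A = 0.
Proof.
move=> fi f0 vA; rewrite /strip; have [vS|vS] := boolP (v \in S).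
  rewrite -(cube_htpyP f vA vS) /cube_htpy vA vS /= f0 raddf0 mulr0 addr0.
  exact: subrr.
rewrite (chain_diff (chain_htpy v fi)) ?fi ?subr0 //.
all: by apply/cellsP => -[_ /subsetP/(_ v vA)]; rewrite (negbTE vS).
Qed.

Lemma normal_strip v f i : chain i f -> cube_cycle f -> normal_at v (strip v f).
Proof.
move=> fi f0 S A vS; split; first exact: strip_eq0 fi f0.
have [vA|vA] := boolP (v \in A); first by rewrite (strip_eq0 _ fi f0) ?raddf0.
rewrite /strip cube_diff_htpy // setU1_id // raddfB /=.
by rewrite /incidence vS divX_mulX subrr.
Qed.

Lemma strip_normal v w f i :
  chain i f -> cube_cycle f -> w != v -> normal_at w f ->
  normal_at w (strip v f).
Proof.
move=> fi f0 wv fw S A wS; have wvS : w \in v |: S by rewrite inE wS orbT.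
have [vA|vA] := boolP (v \in A); first by rewrite (strip_eq0 _ fi f0) ?raddf0.
rewrite /strip cube_diff_htpy //; split.
  by move=> wA; rewrite !(proj1 (fw _ _ _) wA) // raddf0 mulr0 subr0.
rewrite raddfB /= divX_incidence 1?eq_sym // divXC !(proj2 (fw _ _ _)) //.
by rewrite raddf0 mulr0 subr0.
Qed.

Lemma strip_all i f (s : seq 'I_n) : chain i f -> cube_cycle f ->
  exists2 g, chain i.+1 g &
    let f' S A := f S A - cube_diff g S A in
    cube_cycle f' /\ {in s, forall v, normal_at v f'}.
Proof.
move=> fi f0; elim: s => [|v s [g gi [f'0 f'N]]].
  exists (fun _ _ => 0) => //; split=> // S A; rewrite cube_diffB f0 sub0r.
  rewrite [X in - X]big1 ?oppr0 // => a _.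
  by rewrite [X in _ * (_ * X)]big1 ?mulr0 // => b _; rewrite !mulr0.
pose f' S A := f S A - cube_diff g S A.
have f'i : chain i f' by apply: chainB fi (chain_diff gi).
pose g' S A := g S A - (- cube_htpy v f' S A).
have g'E S A : f S A - cube_diff g' S A = strip v f' S A.
  rewrite cube_diffB.
  rewrite [X in _ - (_ - X)](_ : _ = - cube_diff (cube_htpy v f') S A).
    by rewrite opprK opprD addrA.
  by rewrite /cube_diff -sumrN; apply: eq_bigr => a _; rewrite !mulrN.
exists g'.
  by apply: chainB => // S A SAi; rewrite (chain_htpy v f'i) ?oppr0.
split=> [S A|w].
  rewrite (eq_cube_diff g'E) cube_diffB cube_diffK subr0; exact: f'0.
rewrite inE => ws S A; rewrite g'E; move: S A.
have [-> |wv] := eqVneq w v; first exact: normal_strip f'i f'0.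
by apply: (strip_normal f'i) => //; apply: f'N; move: ws; rewrite (negbTE wv).
Qed.

Definition indep_exponent S : 'X_{1..n + n} :=
  (\sum_(v in S) U_(lshift n v) + \sum_(v in ~: S) U_(rshift n v))%MM.

Lemma indep_monomialE S : indep_monomial K S = 'X_[indep_exponent S].
Proof.
by rewrite mpolyXD; congr (_ * _); apply/esym;
  apply: (big_morph (fun u => 'X_[u])) => [u w|]; rewrite ?mpolyXD ?mpolyX0.
Qed.

Lemma indep_exponent_t S v : indep_exponent S (t_idx v) = (v \notin S) :> nat.
Proof.
rewrite mnmDE !mnm_sumE big1 => [|w _]; last first.
  by rewrite mnm1E -val_eqE /= ltn_eqF // ltn_addr.
rewrite add0n (eq_bigr (fun w => w == v : nat)) => [|w _]; last first.
  by rewrite mnm1E (inj_eq (@rshift_inj _ _)).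
rewrite big_mkcond (bigD1 v) //= eqxx inE big1 ?addn0.
  by case: (_ \notin _).
by move=> w /negbTE->; case: ifP.
Qed.

Lemma mdeg_indep_exponent S : mdeg (indep_exponent S) = n.
Proof.
rewrite mdegD !mdeg_sum (eq_bigr (fun=> 1%N)) => [|i _]; last exact: mdeg1.
rewrite [X in (_ + X)%N](eq_bigr (fun=> 1%N)) => [|i _]; last exact: mdeg1.
by rewrite !sum1_card cardsC card_ord.
Qed.

(** In normal form the term with monomial u at S contributes the monomial u m_S
    to the augmentation. The set S is recovered from u m_S as the set of the v
    such that t_v does not divide it, so no two terms can cancel. *)
Lemma cube_aug_normal_eq0 f :
  (forall v, normal_at v f) -> cube_aug f = 0 -> forall S, f S set0 = 0.
Proof.
move=> fN f0 S; apply/mpolyP => u; rewrite mcoeff0; apply/eqP.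
rewrite mcoeff_eq0; apply/negP => uS.
have uS0 v : v \in S -> u (t_idx v) = 0%N.
  by move=> vS; apply: divX_eq0_msupp uS; apply: (proj2 (fN v _ _ vS)).
have := mcoeff_eq0 (f S set0) u; rewrite uS /= => /negbT/eqP; apply.
have := congr1 (mcoeff (indep_exponent S + u)%MM) f0.
rewrite mcoeff0 /cube_aug raddf_sum (bigD1 S) //= indep_monomialE mcoeffMX.
rewrite big1 ?addr0 // => S' S'S; apply/eqP; rewrite mcoeff_eq0 indep_monomialE.
rewrite (perm_mem (msuppMX _ _)); apply: contra S'S => /mapP[u' u'S' uE].
have u'S0 v : v \in S' -> u' (t_idx v) = 0%N.
  by move=> vS; apply: divX_eq0_msupp u'S'; apply: (proj2 (fN v _ _ vS)).
apply/eqP/setP => v.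
have : (indep_exponent S + u)%MM (t_idx v) =
       (indep_exponent S' + u')%MM (t_idx v).
  by rewrite uE.
rewrite [LHS]mnmDE [RHS]mnmDE !indep_exponent_t.
have [vS'|vS'] := boolP (v \in S'); have [vS|vS] := boolP (v \in S) => //=.
  by rewrite u'S0.
by rewrite uS0.
Qed.

(** Stripping all directions leaves a chain that is homologous to f and
    supported on vertices: it is 0 by its degree, or by the injectivity of the
    augmentation on normal forms. *)
Lemma cube_acyclic i f : chain i f -> cube_cycle f ->
  (i = 0%N -> cube_aug f = 0) ->
  exists2 g, chain i.+1 g & forall S A, f S A = cube_diff g S A.
Proof.
move=> fi f0 aug0; have [g gi [f'0 f'N]] := strip_all (enum 'I_n) fi f0.
exists g => // S A; apply/eqP; rewrite -subr_eq0; apply/eqP.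
pose f' S A := f S A - cube_diff g S A; rewrite -/(f' S A).
have f'i : chain i f' by apply: chainB fi (chain_diff gi).
have {}f'N v : normal_at v f' by apply: f'N; rewrite mem_enum.
have [/cellsP[_ AS Ai]|/f'i//] := boolP ((S, A) \in cells i).
have [A0|[v vA]] := set_0Vmem A; last first.
  exact: (proj1 (f'N v S A (subsetP AS v vA)) vA).
have i0 : i = 0%N by rewrite -Ai A0 cards0.
rewrite A0; apply: cube_aug_normal_eq0 => //.
by rewrite cube_augB aug0 // cube_aug_diff subrr.
Qed.

End CubeComplex.

(** * The cube complex as a minimal graded free resolution *)

Section CubeMatrices.
Variables (K : fieldType) (n : nat) (D : {set {set 'I_n}}).
Hypothesis D_down :
  forall S S' : {set 'I_n}, S \in D -> S' \subset S -> S' \in D.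
Local Notation T := {mpoly K[n + n]}.
Implicit Types (S A : {set 'I_n}) (f g : {set 'I_n} -> {set 'I_n} -> T).

Definition cube_rank i := #|cells D i|.

Definition cell_chain (q : {set 'I_n} * {set 'I_n}) S A : T := (q == (S, A))%:R.

Definition chain_of i (x : 'rV[T]_(cube_rank i)) S A : T :=
  \sum_j x 0 j * cell_chain (enum_val j) S A.

Definition row_of i f : 'rV[T]_(cube_rank i) :=
  \row_j f (enum_val j).1 (enum_val j).2.

Definition cube_mx i : 'M[T]_(cube_rank i.+1, cube_rank i) :=
  \matrix_j row_of i (cube_diff (cell_chain (enum_val j))).

Definition cube_aug_mx : 'cV[T]_(cube_rank 0) :=
  \col_j indep_monomial K (enum_val j).1.

Lemma chain_of_chain i (x : 'rV[T]_(cube_rank i)) : chain D i (chain_of x).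
Proof.
move=> S A SA; rewrite /chain_of big1 // => j _; rewrite /cell_chain.
case: eqP => [jSA|_]; last by rewrite mulr0.
by have := enum_valP j; rewrite jSA (negbTE SA).
Qed.

Lemma chain_of_enum_val i (x : 'rV[T]_(cube_rank i)) j :
  chain_of x (enum_val j).1 (enum_val j).2 = x 0 j.
Proof.
rewrite /chain_of (bigD1 j) //= /cell_chain -surjective_pairing eqxx mulr1.
rewrite big1 ?addr0 // => k kj.
by rewrite (inj_eq enum_val_inj) (negbTE kj) mulr0.
Qed.

Lemma chain_ofK i : cancel (@chain_of i) (row_of i).
Proof. by move=> x; apply/rowP => j; rewrite mxE chain_of_enum_val. Qed.

Lemma row_ofK i f :
  chain D i f -> forall S A, chain_of (row_of i f) S A = f S A.
Proof.
move=> fi S A; have [SA|SA] := boolP ((S, A) \in cells D i); last first.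
  by rewrite fi // chain_of_chain.
have := chain_of_enum_val (row_of i f) (enum_rank_in SA (S, A)).
by rewrite mxE enum_rankK_in.
Qed.

Lemma eq_row_of i f g : (forall S A, f S A = g S A) -> row_of i f = row_of i g.
Proof. by move=> fg; apply/rowP => j; rewrite !mxE. Qed.

Lemma cube_mxE i j k : cube_mx i j k =
  cube_diff (cell_chain (enum_val j)) (enum_val k).1 (enum_val k).2.
Proof. by rewrite mxE mxE. Qed.

Lemma mul_cube_mx i (x : 'rV[T]_(cube_rank i.+1)) :
  x *m cube_mx i = row_of i (cube_diff (chain_of x)).
Proof.
apply/rowP => k; rewrite !mxE /cube_diff /chain_of.
under [RHS]eq_bigr => a _ do rewrite !mulr_sumr.
rewrite exchange_big; apply: eq_bigr => j _ /=.
rewrite cube_mxE /cube_diff mulr_sumr; apply: eq_bigr => a _.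
by rewrite mulrCA; congr (_ * _); rewrite mulrCA.
Qed.

Lemma mul_cube_aug_mx (x : 'rV[T]_(cube_rank 0)) :
  (x *m cube_aug_mx) 0 0 = cube_aug (chain_of x).
Proof.
rewrite mxE /cube_aug /chain_of.
under [RHS]eq_bigr => S _ do rewrite mulr_suml.
rewrite exchange_big; apply: eq_bigr => j _ /=.
rewrite mxE (bigD1 (enum_val j).1) //= big1 ?addr0 => [|S Sj]; last first.
  rewrite /cell_chain [enum_val j]surjective_pairing xpair_eqE eq_sym.
  by rewrite (negbTE Sj) mulr0 mul0r.
have /cellsP[_ _ /eqP] : ((enum_val j).1, (enum_val j).2) \in cells D 0.
  by rewrite -surjective_pairing enum_valP.
rewrite cards_eq0 => /eqP j0.
rewrite /cell_chain {2}[enum_val j]surjective_pairing xpair_eqE j0 !eqxx.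
by rewrite mulr1.
Qed.

Lemma cube_mx_exact i (x : 'rV[T]_(cube_rank i.+1)) :
  x *m cube_mx i = 0 <-> exists y, x = y *m cube_mx i.+1.
Proof.
split=> [x0|[y ->]]; last first.
  rewrite !mul_cube_mx; apply/rowP => j; rewrite !mxE.
  rewrite (eq_cube_diff (row_ofK (chain_diff D_down (chain_of_chain y)))).
  exact: cube_diffK.
have [|//|g gi gE] := cube_acyclic D_down (chain_of_chain x).
  move=> S A; rewrite -(row_ofK (chain_diff D_down (chain_of_chain x))).
  by rewrite -mul_cube_mx x0 /chain_of big1 // => j _; rewrite mxE mul0r.
exists (row_of _ g); rewrite mul_cube_mx -[LHS]chain_ofK.
apply: eq_row_of => S A.
by rewrite gE; apply: eq_cube_diff => {}S {}A; rewrite row_ofK.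
Qed.

Lemma eq_cube_aug f g : (forall S A, f S A = g S A) -> cube_aug f = cube_aug g.
Proof. by move=> fg; apply: eq_bigr => S _; rewrite fg. Qed.

Lemma cube_mx_exact0 (x : 'rV[T]_(cube_rank 0)) :
  x *m cube_aug_mx = 0 <-> exists y, x = y *m cube_mx 0.
Proof.
split=> [x0|[y ->]]; last first.
  apply/matrixP => i j; rewrite !ord1 mul_cube_aug_mx mul_cube_mx mxE.
  rewrite (eq_cube_aug (row_ofK (chain_diff D_down (chain_of_chain y)))).
  exact: cube_aug_diff.
have [||g gi gE] := cube_acyclic D_down (chain_of_chain x).
- move=> S A; rewrite /cube_diff big1 // => a aA.
  rewrite chain_of_chain ?mulr0 //; apply/cellsP => -[_ _ /eqP].
  by rewrite cardsU1 aA.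
- by rewrite -mul_cube_aug_mx x0 mxE.
exists (row_of _ g); rewrite mul_cube_mx -[LHS]chain_ofK.
apply: eq_row_of => S A.
by rewrite gE; apply: eq_cube_diff => {}S {}A; rewrite row_ofK.
Qed.

Lemma cube_aug_image (p : T) :
  ideal_gen D (@indep_monomial K n) p <->
  exists x : 'rV[T]_(cube_rank 0), p = (x *m cube_aug_mx) 0 0.
Proof.
split=> [/asboolP[c ->]|[x ->]].
  pose f S A : T := if (S \in D) && (A == set0) then c S else 0.
  have f0 : chain D 0 f.
    move=> S A; rewrite /f; case: ifP => // /andP[SD /eqP->] /negP[].
    by apply/cellsP; rewrite cards0 sub0set.
  exists (row_of 0 f); rewrite mul_cube_aug_mx (eq_cube_aug (row_ofK f0)).
  rewrite /cube_aug big_mkcond; apply: eq_bigr => S _.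
  by rewrite /f eqxx andbT; case: ifP => _; rewrite ?mul0r.
apply/asboolP; exists (fun S => chain_of x S set0).
rewrite mul_cube_aug_mx [RHS]big_mkcond; apply: eq_bigr => S _.
case: ifPn => // SD; rewrite chain_of_chain ?mul0r //.
by apply/cellsP => -[SD']; rewrite SD' in SD.
Qed.

Lemma cube_mx_homog i j k : cube_mx i j k \is 1.-homog.
Proof.
rewrite cube_mxE; apply: rpred_sum => a _; rewrite rpredMsign.
rewrite /cell_chain -mulr_natr mul1r mulr_natr rpredMn //.
by rewrite /incidence; case: ifP => _; rewrite ?rpredN dhomogX /= mdeg1.
Qed.

Lemma homog_homogz m d (p : {mpoly K[m]}) : p \is d.-homog -> homogz d%:Z p.
Proof. by move=> /dhomogP pd u /pd ->. Qed.

Lemma cube_aug_mx_homog j : homogz n%:Z (cube_aug_mx j 0).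
Proof.
apply: homog_homogz; rewrite mxE indep_monomialE dhomogX.
by rewrite /= mdeg_indep_exponent.
Qed.

Lemma cube_mx_homogz i j k :
  homogz ((i.+1 + n)%:Z - (i + n)%:Z) (cube_mx i j k).
Proof.
have -> : (i.+1 + n)%:Z - (i + n)%:Z = 1%:Z.
  by rewrite addSn -addn1 PoszD addrAC subrr add0r.
exact: homog_homogz (cube_mx_homog j k).
Qed.

Lemma cube_mx_minimal i j k : (cube_mx i j k)@_0%MM = 0.
Proof. by apply: (dhomog_nemf_coeff (cube_mx_homog j k)); rewrite /= mdeg0. Qed.

Definition cube_ideal : submodClosed T^o :=
  GRing.SubmodClosed.clone _ _ (ideal_gen D (@indep_monomial K n)) _.

(** All the entries of the differentials have degree 1, so this resolution is
    linear: it is minimal, with a single shift in each homological degree. *)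
Definition cube_resolution : min_graded_free_resolution cube_ideal :=
  @MinGradedFreeResolution K (n + n) cube_ideal
    cube_rank (fun i _ => (i + n)%:Z) cube_aug_mx cube_mx
    cube_aug_mx_homog cube_mx_homogz cube_aug_image cube_mx_exact0 cube_mx_exact
    cube_mx_minimal.

Lemma cube_rankE i : cube_rank i = (\sum_(S in D) 'C(#|S|, i))%N.
Proof.
rewrite /cube_rank -sum1_card.
rewrite (partition_big (fun q => q.1) (mem D)) /=; last first.
  by move=> q; rewrite inE => /andP[].
apply: eq_bigr => S SD; rewrite -[in RHS]cards_draws -sum1_card.
rewrite (reindex_onto (fun A => (S, A)) snd) /=; last first.
  by case=> S' A /= /andP[_ /eqP->].
by apply: eq_bigl => A; rewrite !inE /= SD !eqxx !andbT.
Qed.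

End CubeMatrices.

(** Each generator has degree n, one variable for each vertex. *)
Lemma indep_ideal_proper (K : fieldType) n (e : rel 'I_n)
    (p : {mpoly K[n + n]}) :
  (0 < n)%N -> p \in indep_ideal K e -> p@_0%MM = 0.
Proof.
move=> n_gt0 /asboolP[c ->]; rewrite raddf_sum big1 // => S _ /=.
rewrite rmorphM /= indep_monomialE mcoeffX -mdeg_eq0 mdeg_indep_exponent.
by rewrite eqn0Ngt n_gt0 mulr0.
Qed.

(** * Independent sets of paths *)

Lemma independentP n (e : rel 'I_n) (S : {set 'I_n}) :
  reflect {in S &, forall i j, ~~ e i j} (independent e S).
Proof.
apply: (iffP forall_inP) => [eS i j iS jS | eS i iS].
  by have /forall_inP := eS i iS; apply.
by apply/forall_inP => j jS; apply: eS.
Qed.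

Lemma independentS n (e : rel 'I_n) (S S' : {set 'I_n}) :
  S \in [set S | independent e S] -> S' \subset S ->
  S' \in [set S | independent e S].
Proof.
rewrite !inE => /independentP eS /subsetP S'S.
by apply/independentP => i j iS' jS'; apply: eS; apply: S'S.
Qed.

Section PathIndependentSets.
Variable n : nat.

Definition path_indep_sets m k := [set S : {set 'I_n} |
  [&& independent (@path_graph n) S, [forall i in S, (i < m)%N] & #|S| == k]].

Lemma path_indep_setsP m k (S : {set 'I_n}) :
  reflect [/\ {in S &, forall i j : 'I_n, (i.+1 != j)%N},
              {in S, forall i : 'I_n, (i < m)%N} & #|S| = k]
          (S \in path_indep_sets m k).
Proof.
rewrite inE; apply: (iffP and3P).
  case=> /independentP eS /forall_inP Sm /eqP Sk.
  split=> // i j iS jS; have := eS i j iS jS.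
  by rewrite /path_graph negb_or => /andP[].
case=> eS Sm Sk; split; [|exact/forall_inP|exact/eqP].
apply/independentP => i j iS jS; rewrite /path_graph negb_or.
by rewrite !eS.
Qed.

Lemma card_path_indep_sets0 m : #|path_indep_sets m 0| = 1%N.
Proof.
rewrite [path_indep_sets m 0](_ : _ = [set set0]) ?cards1 //.
apply/setP => S; rewrite in_set1; apply/path_indep_setsP/eqP => [[_ _ /eqP]|->].
  by rewrite cards_eq0 => /eqP.
by split=> [i j|i|]; rewrite ?inE // cards0.
Qed.

(** The independent sets of the path on the m.+1 first vertices that contain the
    last one do not contain its neighbour, so they come from the path on m.-1
    vertices; with m = 0 the truncated predecessor still gives the right count.
    Keeping all of them inside the same type of sets avoids any transport. *)
Lemma card_path_indep_setsS m k : (m < n)%N ->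
  #|path_indep_sets m.+1 k.+1| =
    (#|path_indep_sets m k.+1| + #|path_indep_sets m.-1 k|)%N.
Proof.
move=> m_lt; pose v := Ordinal m_lt.
rewrite -!sum1_card (bigID (fun S : {set 'I_n} => v \notin S)) /=.
congr (_ + _)%N.
  apply: eq_bigl => S; apply/andP/path_indep_setsP => [[]|].
    case/path_indep_setsP => eS Sm Sk vS; split=> // i iS.
    rewrite ltn_neqAle -ltnS Sm // andbT; apply: contraNneq vS => im.
    by rewrite (_ : v = i) //; apply: val_inj.
  case=> eS Sm Sk; split; last by apply/negP => /Sm; rewrite /= ltnn.
  by apply/path_indep_setsP; split=> // i /Sm /leqW.
rewrite (reindex_onto (fun S => v |: S) (fun S => S :\ v)) /=; last first.
  by move=> S /andP[_ /negPn]; apply: setD1K.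
apply: eq_bigl => S; rewrite setU11 andbT; apply/andP/path_indep_setsP.
  case=> /path_indep_setsP[eS Sm Sk] /eqP vS.
  have vNS : v \notin S by rewrite -vS !inE eqxx.
  split.
  - by move=> i j iS jS; apply: eS; rewrite inE ?iS ?jS orbT.
  - move=> i iS; have ivS : i \in v |: S by rewrite inE iS orbT.
    have := Sm i ivS; have := eS i v ivS (setU11 _ _).
    have : (i : nat) != m.
      by apply: contraNneq vNS => im; rewrite (_ : v = i) //; apply: val_inj.
    by rewrite /=; lia.
  - by move: Sk; rewrite cardsU1 vNS => -[].
case=> eS Sm Sk.
have vNS : v \notin S by apply/negP => /Sm /=; lia.
split; last by rewrite setU1K.
apply/path_indep_setsP; split.
- move=> i j; rewrite !inE => /predU1P[->|iS] /predU1P[->|jS] /=.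
  + by lia.
  + by have := Sm j jS; lia.
  + by have := Sm i iS; lia.
  + exact: eS.
- by move=> i; rewrite !inE => /predU1P[->|/Sm] /=; lia.
- by rewrite cardsU1 vNS Sk.
Qed.

Lemma card_path_indep_sets m k :
  (m <= n)%N -> #|path_indep_sets m k| = 'C(m + 1 - k, k).
Proof.
elim/ltn_ind: m k => -[_|m IHm] [|k] m_le;
  rewrite ?card_path_indep_sets0 ?bin0 //.
  rewrite bin_small; last by lia.
  apply/eqP; rewrite cards_eq0; apply/eqP/setP => S; rewrite in_set0.
  apply/path_indep_setsP => -[_ S0 /eqP]; rewrite -[S](_ : set0 = S) ?cards0 //.
  by apply/setP => i; rewrite in_set0; apply/esym/negP => /S0.
rewrite card_path_indep_setsS // !IHm; try lia.
case: (posnP m) => [->|m_gt0].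
  by case: k => [|k] //=; rewrite !bin_small //; lia.
have [km|mk] := leqP k m; last by rewrite !bin_small; lia.
rewrite (_ : m.+1 + 1 - k.+1 = (m - k).+1)%N; last lia.
by rewrite binS; congr ('C(_, _) + 'C(_, _))%N; lia.
Qed.

End PathIndependentSets.

(** Beyond this bound the binomial coefficient that counts the independent sets
    of that size vanishes. *)
Lemma card_path_independent n (S : {set 'I_n}) :
  independent (@path_graph n) S -> (#|S| <= (n + 1) %/ 2)%N.
Proof.
move=> eS; have: (0 < #|path_indep_sets n n #|S| |)%N.
  apply/card_gt0P; exists S; rewrite inE eS eqxx andbT /=.
  by apply/forall_inP => i _.
rewrite card_path_indep_sets // bin_gt0; lia.
Qed.

Lemma cube_rank_path n i :
  cube_rank [set S | independent (@path_graph n) S] i =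
  (\sum_(0 <= k < ((n + 1) %/ 2).+1) 'C(n + 1 - k, k) * 'C(k, i))%N.
Proof.
rewrite cube_rankE big_mkord.
pose size_of (S : {set 'I_n}) : 'I_((n + 1) %/ 2).+1 := inord #|S|.
rewrite (partition_big size_of predT) //=.
apply: eq_bigr => k _; rewrite -(@card_path_indep_sets n n) // -sum_nat_const.
rewrite /size_of; apply: eq_big => [S|S /andP[]]; last first.
  by rewrite inE => /card_path_independent Sn /eqP <-; rewrite inordK.
rewrite !inE.
case: (boolP (independent _ S)) => //= /card_path_independent Sn.
rewrite -val_eqE /= inordK // andbC; case: eqP => //= _.
by apply/esym/forall_inP => j _.
Qed.

Local Close Scope ring_scope.

Theorem proposition3p1 (K : fieldType) (n : nat) (n_ge1 : 1 <= n) :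
  (forall i : nat,
     betti_eq (indep_ideal K (@path_graph n)) i
       (\sum_(0 <= k < ((n + 1) %/ 2).+1) 'C(n + 1 - k, k) * 'C(k, i)))
  /\ proj_dim_eq (quot_mod (indep_ideal K (@path_graph n)))
       ((n + 1) %/ 2 + 1).
Proof.
pose F : min_graded_free_resolution (indep_ideal K (@path_graph n)) :=
  cube_resolution K (@independentS n (@path_graph n)).
have rankE i : mr_rank F i = _ := cube_rank_path n i.
have I_proper p := @indep_ideal_proper K n (@path_graph n) p n_ge1.
split=> [i|].
  by split=> [|G]; [exists | rewrite -rankE; apply: mr_rank_unique].
rewrite addn1; apply: (proj_dim_quotient I_proper (F := F)) => [|i di].
  (* The term k = (n + 1) %/ 2 of the sum is positive. *)
  by rewrite rankE big_nat_recr //= binn muln1 addn_gt0 bin_gt0; lia.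
rewrite rankE big_nat_cond big1 // => k /andP[/andP[_ kd] _].
by rewrite [X in _ * X]bin_small ?muln0 // (leq_trans kd).
Qed.
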